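(* Let $b\in\mathbb R$ and $c=c_0+c_1\mathbf i+c_2\mathbf j+c_3\mathbf k\in\mathbb H_s$, and consider the equation $x^2+bx+c=0$ in the unknown $x\in\mathbb H_s$. The equation is solvable if and only if $\sqrt[s]{\frac{b^2-4c}{4}}\neq\emptyset$. If it is solvable, its solutions are given by $x=\frac{-b}{2}+\sqrt[s]{\frac{b^2-4c}{4}}$ (i.e. the solutions are the elements $-\frac b2+s$ with $s\in\sqrt[s]{\frac{b^2-4c}{4}}$). In other words, the solutions are obtained by the following formulas. Put $K(c)=-c_1^2+c_2^2+c_3^2$. (1) If $b,c\in\mathbb R$ and $b^2<4c$, then the solutions are $x=\frac{-b}{2}+x_1\mathbf i+x_2\mathbf j+x_3\mathbf k$, where $x_1,x_2,x_3\in\mathbb R$ and $-x_1^2+x_2^2+x_3^2=\frac{b^2-4c}{4}$. (2) If $b,c\in\mathbb R$ and $b^2\ge 4c$, then the set of solutions is $\left\{\frac{-b\pm\sqrt{b^2-4c}}{2}\right\}\cup\left\{\frac{-b}{2}+x_1\mathbf i+x_2\mathbf j+x_3\mathbf k:\ x_1,x_2,x_3\in\mathbb R,\ -x_1^2+x_2^2+x_3^2=\frac{b^2-4c}{4}\right\}$. (3) If $c\notin\mathbb R$, $(b^2-4c_0)^2-16K(c)\ge 0$ and $\frac{b^2-4c_0+\sqrt{(b^2-4c_0)^2-16K(c)}}{2}>0$, then the solutions are as follows. (i) If $\frac{b^2-4c_0-\sqrt{(b^2-4c_0)^2-16K(c)}}{2}>0$, then $$x=\tfrac12(-b\pm\rho_i)\mp\tfrac1{\rho_i}(c_1\mathbf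 i+c_2\mathbf j+c_3\mathbf k),\quad i=1,2,$$ where $\rho_{1,2}=\sqrt{\frac{b^2-4c_0\pm\sqrt{(b^2-4c_0)^2-16K(c)}}{2}}$. (ii) If $\frac{b^2-4c_0+\sqrt{(b^2-4c_0)^2-16K(c)}}{2}>0\ge\frac{b^2-4c_0-\sqrt{(b^2-4c_0)^2-16K(c)}}{2}$, then $$x=\tfrac12(-b\pm\rho)\mp\tfrac1\rho(c_1\mathbf i+c_2\mathbf j+c_3\mathbf k),$$ where $\rho=\sqrt{\frac{b^2-4c_0+\sqrt{(b^2-4c_0)^2-16K(c)}}{2}}$.
   Context: $\mathbb H_s$ is the split quaternion algebra: the 4-dimensional associative real algebra with basis $1,\mathbf i,\mathbf j,\mathbf k$ and $\mathbf i^2=-1$, $\mathbf j^2=\mathbf k^2=1$, $\mathbf i\mathbf j=\mathbf k=-\mathbf j\mathbf i$, $\mathbf j\mathbf k=-\mathbf i=-\mathbf k\mathbf j$, $\mathbf k\mathbf i=\mathbf j=-\mathbf i\mathbf k$. Elements are $x=x_0+x_1\mathbf i+x_2\mathbf j+x_3\mathbf k$ with $x_i\in\mathbb R$; $\mathbb R$ is identified with the real multiples of $1$. For $w\in\mathbb H_s$, $\sqrt[s]{w}=\{x\in\mathbb H_s: x^2=w\}$ (a set). In formulas with $\pm$ and $\mp$, upper signs go together and lower signs go together. *)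

(* Defs.v *)
From HB Require Import structures.
From mathcomp Require Import all_boot all_order all_algebra ring.
From mathcomp Require Import boolp classical_sets reals.

Set Implicit Arguments.
Unset Strict Implicit.
Unset Printing Implicit Defensive.

Import Order.TTheory GRing.Theory Num.Theory.

Local Open Scope ring_scope.
Local Open Scope classical_set_scope.

(* [SplitQ x0 x1 x2 x3] is x0 + x1 i + x2 j + x3 k, see [splitqE]. *)
Record splitq (R : Type) := SplitQ { sq0 : R; sq1 : R; sq2 : R; sq3 : R }.

Definition sq_to_prod (R : Type) (x : splitq R) : R * R * R * R :=
  (sq0 x, sq1 x, sq2 x, sq3 x).
Definition sq_of_prod (R : Type) (p : R * R * R * R) : splitq R :=
  let: (x0, x1, x2, x3) := p in SplitQ x0 x1 x2 x3.
Lemma sq_to_prodK (R : Type) : cancel (@sq_to_prod R) (@sq_of_prod R).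
Proof. by case. Qed.

HB.instance Definition _ (R : choiceType) :=
  Choice.copy (splitq R) (can_type (@sq_to_prodK R)).

Lemma splitqP (R : Type) (x y : splitq R) :
  sq0 x = sq0 y -> sq1 x = sq1 y -> sq2 x = sq2 y -> sq3 x = sq3 y -> x = y.
Proof. by case: x y => [x0 x1 x2 x3] [y0 y1 y2 y3] /= -> -> -> ->. Qed.

Definition sq_zero (R : zmodType) : splitq R := SplitQ 0 0 0 0.
Definition sq_opp (R : zmodType) (x : splitq R) : splitq R :=
  SplitQ (- sq0 x) (- sq1 x) (- sq2 x) (- sq3 x).
Definition sq_add (R : zmodType) (x y : splitq R) : splitq R :=
  SplitQ (sq0 x + sq0 y) (sq1 x + sq1 y) (sq2 x + sq2 y) (sq3 x + sq3 y).

Lemma sq_addA (R : zmodType) : associative (@sq_add R).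
Proof. by move=> x y z; apply: splitqP; apply: addrA. Qed.
Lemma sq_addC (R : zmodType) : commutative (@sq_add R).
Proof. by move=> x y; apply: splitqP; apply: addrC. Qed.
Lemma sq_add0 (R : zmodType) : left_id (@sq_zero R) (@sq_add R).
Proof. by move=> x; apply: splitqP; apply: add0r. Qed.
Lemma sq_addN (R : zmodType) :
  left_inverse (@sq_zero R) (@sq_opp R) (@sq_add R).
Proof. by move=> x; apply: splitqP; apply: addNr. Qed.

HB.instance Definition _ (R : zmodType) :=
  GRing.isZmodule.Build (splitq R)
    (@sq_addA R) (@sq_addC R) (@sq_add0 R) (@sq_addN R).

Definition sq_one (R : comNzRingType) : splitq R := SplitQ 1 0 0 0.

(* Bilinear extension of the multiplication table, see [splitq_table]. *)
Definition sq_mul (R : comNzRingType) (x y : splitq R) : splitq R :=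
  let: SplitQ x0 x1 x2 x3 := x in
  let: SplitQ y0 y1 y2 y3 := y in
  SplitQ (x0 * y0 - x1 * y1 + x2 * y2 + x3 * y3)
         (x0 * y1 + x1 * y0 - x2 * y3 + x3 * y2)
         (x0 * y2 - x1 * y3 + x2 * y0 + x3 * y1)
         (x0 * y3 + x1 * y2 - x2 * y1 + x3 * y0).

Lemma sq_mulA (R : comNzRingType) : associative (@sq_mul R).
Proof.
by move=> [x0 x1 x2 x3] [y0 y1 y2 y3] [z0 z1 z2 z3]; apply: splitqP => /=; ring.
Qed.
Lemma sq_mul1l (R : comNzRingType) : left_id (@sq_one R) (@sq_mul R).
Proof. by move=> [x0 x1 x2 x3]; apply: splitqP => /=; ring. Qed.
Lemma sq_mul1r (R : comNzRingType) : right_id (@sq_one R) (@sq_mul R).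
Proof. by move=> [x0 x1 x2 x3]; apply: splitqP => /=; ring. Qed.
Lemma sq_mulDl (R : comNzRingType) : left_distributive (@sq_mul R) +%R.
Proof.
by move=> [x0 x1 x2 x3] [y0 y1 y2 y3] [z0 z1 z2 z3]; apply: splitqP => /=; ring.
Qed.
Lemma sq_mulDr (R : comNzRingType) : right_distributive (@sq_mul R) +%R.
Proof.
by move=> [x0 x1 x2 x3] [y0 y1 y2 y3] [z0 z1 z2 z3]; apply: splitqP => /=; ring.
Qed.
Lemma sq_one_neq0 (R : comNzRingType) : @sq_one R != 0.
Proof. by apply/eqP => /(congr1 (@sq0 R)) /eqP; rewrite oner_eq0. Qed.

HB.instance Definition _ (R : comNzRingType) :=
  GRing.Zmodule_isNzRing.Build (splitq R) (@sq_mulA R) (@sq_mul1l R)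
    (@sq_mul1r R) (@sq_mulDl R) (@sq_mulDr R) (@sq_one_neq0 R).

Definition sq_scale (R : comNzRingType) (a : R) (x : splitq R) : splitq R :=
  SplitQ (a * sq0 x) (a * sq1 x) (a * sq2 x) (a * sq3 x).

Lemma sq_scaleA (R : comNzRingType) (a b : R) (x : splitq R) :
  sq_scale a (sq_scale b x) = sq_scale (a * b) x.
Proof. by apply: splitqP; apply: mulrA. Qed.
Lemma sq_scale1 (R : comNzRingType) : left_id 1 (@sq_scale R).
Proof. by move=> x; apply: splitqP; apply: mul1r. Qed.
Lemma sq_scaleDr (R : comNzRingType) : right_distributive (@sq_scale R) +%R.
Proof. by move=> a x y; apply: splitqP; apply: mulrDr. Qed.
Lemma sq_scaleDl (R : comNzRingType) (x : splitq R) :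
  {morph (@sq_scale R)^~ x : a b / a + b}.
Proof. by move=> a b; apply: splitqP; apply: mulrDl. Qed.

HB.instance Definition _ (R : comNzRingType) :=
  GRing.Zmodule_isLmodule.Build R (splitq R) (@sq_scaleA R) (@sq_scale1 R)
    (@sq_scaleDr R) (@sq_scaleDl R).

Lemma sq_scaleAl (R : comNzRingType) (a : R) (x y : splitq R) :
  a *: (x * y) = (a *: x) * y.
Proof.
by case: x y => [x0 x1 x2 x3] [y0 y1 y2 y3]; apply: splitqP => /=; ring.
Qed.
Lemma sq_scaleAr (R : comNzRingType) (a : R) (x y : splitq R) :
  a *: (x * y) = x * (a *: y).
Proof.
by case: x y => [x0 x1 x2 x3] [y0 y1 y2 y3]; apply: splitqP => /=; ring.
Qed.

HB.instance Definition _ (R : comNzRingType) :=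
  GRing.Lmodule_isLalgebra.Build R (splitq R) (@sq_scaleAl R).
HB.instance Definition _ (R : comNzRingType) :=
  GRing.Lalgebra_isAlgebra.Build R (splitq R) (@sq_scaleAr R).

Definition sqi (R : comNzRingType) : splitq R := SplitQ 0 1 0 0.
Definition sqj (R : comNzRingType) : splitq R := SplitQ 0 0 1 0.
Definition sqk (R : comNzRingType) : splitq R := SplitQ 0 0 0 1.

Arguments sqi {R}.
Arguments sqj {R}.
Arguments sqk {R}.

Lemma splitqE (R : comNzRingType) (x0 x1 x2 x3 : R) :
  SplitQ x0 x1 x2 x3 = x0%:A + x1 *: sqi + x2 *: sqj + x3 *: sqk.
Proof. by apply: splitqP => /=; ring. Qed.

Lemma splitq_table (R : comNzRingType) :
  (sqi * sqi = -1 :> splitq R) /\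
  (sqj * sqj = 1 :> splitq R) /\ (sqk * sqk = 1 :> splitq R) /\
  (sqi * sqj = sqk :> splitq R) /\ (sqj * sqi = - sqk :> splitq R) /\
  (sqj * sqk = - sqi :> splitq R) /\ (sqk * sqj = sqi :> splitq R) /\
  (sqk * sqi = sqj :> splitq R) /\ (sqi * sqk = - sqj :> splitq R).
Proof. by do ![split]; apply: splitqP => /=; ring. Qed.

Definition sq_real (R : realType) : set (splitq R) := range (fun r : R => r%:A).

Definition sqsqrt (R : realType) (w : splitq R) : set (splitq R) :=
  [set x | x ^+ 2 = w].

Definition sqK (R : realType) (c : splitq R) : R :=
  - sq1 c ^+ 2 + sq2 c ^+ 2 + sq3 c ^+ 2.

Definition quad_sols (R : realType) (b : R) (c : splitq R) : set (splitq R) :=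
  [set x | x ^+ 2 + b *: x + c = 0].

(* Main.v *)
Require Import Defs.
From mathcomp Require Import all_boot all_order all_algebra.
From mathcomp Require Import boolp classical_sets reals.
From mathcomp Require Import ring lra.

Import Order.TTheory GRing.Theory Num.Theory.

Local Open Scope ring_scope.
Local Open Scope classical_set_scope.

(** Because [b] is real it commutes with everything, so completing the square
    turns [x ^+ 2 + b *: x + c = 0] into [s ^+ 2 = w] with [s = x + b / 2] and
    [w = (b ^ 2 - 4 c) / 4] ([quad_sols_shift]); the rest is the computation of
    square roots in the split quaternions.

    Write [s = s0 + v] with [s0] real and [v] imaginary.  Imaginary elements
    square to the real number [K v], so [s ^ 2 = (s0 ^ 2 + K v) + 2 s0 v], and
    [s ^ 2 = w] says [s0 ^ 2 + K v = w0] and [2 s0 v = im w] ([sqsqrtP]).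

    If [w] is real, then [s0 = 0] or [v = 0]: either [s] is imaginary with
    [K s = w], or [s] is a real square root of [w] ([sqsqrt_realP]).  The latter
    exists exactly when [w] is nonnegative, whence cases (1) and (2).

    If [w] is not real, then [s0 <> 0], and [rho = 2 s0] determines
    [v = rho^-1 im w].  The remaining equation says that [t = rho ^ 2] is a root
    of [t ^ 2 - 4 w0 t + 4 K w] ([sqsqrt_nonrealP]).  The roots of this
    polynomial are [t1 >= t2] ([quadratic_rootP]), and each positive one gives
    the two values [rho = sqrt t] and [rho = - sqrt t], while a root [t <= 0]
    gives none ([sqr_eq_sqrtP]).  Hence four solutions when [t2 > 0], two when
    [t1 > 0 >= t2], and none when [t1 <= 0] or the discriminant is negative. *)

Definition sq_im {R : comNzRingType} (x : splitq R) : splitq R :=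
  sq1 x *: sqi + sq2 x *: sqj + sq3 x *: sqk.

Lemma sq_realP (R : realType) (x : splitq R) :
  sq_real x <-> [/\ sq1 x = 0, sq2 x = 0 & sq3 x = 0].
Proof.
split=> [[r _ <-]|[x1 x2 x3]]; first by split=> /=; ring.
by exists (sq0 x) => //; apply: splitqP => /=; rewrite ?x1 ?x2 ?x3; ring.
Qed.

Lemma sqsqrtP (R : realType) (w s : splitq R) :
  sqsqrt w s <->
  [/\ sq0 s ^+ 2 + sqK s = sq0 w, 2 * sq0 s * sq1 s = sq1 w,
      2 * sq0 s * sq2 s = sq2 w & 2 * sq0 s * sq3 s = sq3 w].
Proof.
rewrite /sqsqrt /sqK /= expr2.
case: w s => [w0 w1 w2 w3] [s0 s1 s2 s3] /=; split=> [[<- <- <- <-]|[]].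
  by split; ring.
by move=> <- <- <- <-; apply: splitqP => /=; ring.
Qed.

(** Completing the square: the cross terms [s * (b / 2)] and [(b / 2) * s] agree
    because [b] is real. *)
Lemma quad_sols_shift (R : realType) (b : R) (c : splitq R) :
  quad_sols b c =
  [set (- b / 2)%:A + s | s in sqsqrt (4^-1 *: ((b ^+ 2)%:A - 4 *: c))].
Proof.
have shift s : ((- b / 2)%:A + s) ^+ 2 + b *: ((- b / 2)%:A + s) + c =
    s ^+ 2 - 4^-1 *: ((b ^+ 2)%:A - 4 *: c).
  by case: s c => [s0 s1 s2 s3] [c0 c1 c2 c3]; rewrite !expr2;
    apply: splitqP => /=; field.
apply/seteqP; split=> [x xE|_ [s sE <-]].
  exists (x - (- b / 2)%:A); last by rewrite addrC subrK.
  by apply/eqP; rewrite -subr_eq0 -shift subrKC; apply/eqP.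
by rewrite /quad_sols /= shift sE subrr.
Qed.

Lemma sqsqrt_realP (R : realType) (d : R) (s : splitq R) :
  sqsqrt d%:A s <->
  (exists2 y, y ^+ 2 = d & s = y%:A) \/ (sq0 s = 0 /\ sqK s = d).
Proof.
rewrite sqsqrtP /sqK /= mulr1 mulr0; split=> [[e0 e1 e2 e3]|[[y yd ->]|[-> Ks]]].
- have [s0|s0] := eqVneq (sq0 s) 0; first by right; split=> //; rewrite -e0 s0; ring.
  have im0 a : 2 * sq0 s * a = 0 -> a = 0.
    by move=> /eqP; rewrite !mulf_eq0 (negPf s0) pnatr_eq0 => /eqP.
  left; exists (sq0 s); last first.
    by apply: splitqP => /=; rewrite ?(im0 _ e1) ?(im0 _ e2) ?(im0 _ e3); ring.
  by rewrite -e0 (im0 _ e1) (im0 _ e2) (im0 _ e3); ring.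
- by rewrite /= -yd; split; ring.
- by rewrite -Ks; split; ring.
Qed.

Lemma sqsqrt_nonrealP (R : realType) (w s : splitq R) : ~ sq_real w ->
  sqsqrt w s <->
  exists rho, [/\ rho != 0,
    (rho ^+ 2) ^+ 2 - 4 * sq0 w * rho ^+ 2 + 4 * sqK w = 0
    & s = (rho / 2)%:A + rho^-1 *: sq_im w].
Proof.
move=> wNreal; rewrite sqsqrtP /sqK; split=> [[e0 e1 e2 e3]|[rho [rho0 root ->]]].
  have s0 : sq0 s != 0.
    apply: contra_notN wNreal => /eqP s0; apply/sq_realP.
    by rewrite -e1 -e2 -e3 s0; split; ring.
  exists (2 * sq0 s); split; first by rewrite mulf_neq0 ?pnatr_eq0.
    by rewrite -e0 -e1 -e2 -e3; ring.
  by apply: splitqP => /=; rewrite -?e1 -?e2 -?e3; field.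
split=> /=; try by field.
(* The real-part equation is the equation for [rho] divided by
   [4 * rho ^+ 2]. *)
apply/eqP; rewrite -subr_eq0; apply/eqP.
by apply: etrans (mul0r (4 * rho ^+ 2)^-1); rewrite -[in RHS]root; field.
Qed.

Lemma quadratic_rootP {R : realType} (D k t : R) :
  let Delta := D ^+ 2 - 16 * k in
  t ^+ 2 - D * t + 4 * k = 0 <->
  0 <= Delta /\
  (t = (D + Num.sqrt Delta) / 2 \/ t = (D - Num.sqrt Delta) / 2).
Proof.
move=> Delta; split=> [root|[Delta0 tE]].
  have DeltaE : Delta = (2 * t - D) ^+ 2.
    by apply/eqP; rewrite -subr_eq0 -(mulr0 (- 4)) -root /Delta; apply/eqP; ring.
  rewrite DeltaE sqr_ge0 sqrtr_sqr; split=> //.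
  by case: (ger0P (2 * t - D)) => _; [left|right]; field.
have := sqr_sqrtr Delta0; set r := Num.sqrt Delta in tE * => rE.
have -> : 4 * k = (D ^+ 2 - r ^+ 2) / 4 by rewrite rE /Delta; field.
by case: tE => ->; field.
Qed.

Lemma sqr_eq_sqrtP {R : realType} (t rho : R) :
  rho != 0 /\ rho ^+ 2 = t <->
  0 < t /\ (rho = Num.sqrt t \/ rho = - Num.sqrt t).
Proof.
split=> [[rho0 <-]|[t0 rhoE]].
  rewrite exprn_even_gt0 //= rho0 sqrtr_sqr; split=> //.
  by case: (ger0P rho) => _; [left|right]; rewrite ?opprK.
have r0 : Num.sqrt t != 0 by rewrite gt_eqF ?sqrtr_gt0.
have rE := sqr_sqrtr (ltW t0).
by case: rhoE => ->; rewrite ?oppr_eq0 ?sqrrN.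
Qed.

(** Here [rho] runs over all nonzero reals, of either sign: the solutions with
    the lower signs are those of the upper signs for [- rho]. *)
Lemma quad_sols_nonrealP {R : realType} (b : R) (c x : splitq R) :
  let D := b ^+ 2 - 4 * sq0 c in
  let Delta := D ^+ 2 - 16 * sqK c in
  ~ sq_real c ->
  quad_sols b c x <->
  exists rho, [/\ rho != 0, 0 <= Delta,
    rho ^+ 2 = (D + Num.sqrt Delta) / 2 \/ rho ^+ 2 = (D - Num.sqrt Delta) / 2
    & x = (2^-1 * (- b + rho))%:A - rho^-1 *: sq_im c].
Proof.
move=> D Delta cNreal; rewrite quad_sols_shift.
set w := 4^-1 *: _.
have wE : [/\ 4 * sq0 w = D, sq1 w = - sq1 c, sq2 w = - sq2 c
    & sq3 w = - sq3 c].
  by split; rewrite /w /D /=; field.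
clearbody w; case: wE => w0 w1 w2 w3.
have wNreal : ~ sq_real w.
  move=> /sq_realP; rewrite w1 w2 w3 => -[/eqP + /eqP + /eqP].
  rewrite !oppr_eq0 => /eqP c1 /eqP c2 /eqP c3.
  by apply: cNreal; apply/sq_realP.
have KwE : sqK w = sqK c by rewrite /sqK w1 w2 w3 !sqrrN.
have xE rho : (- b / 2)%:A + ((rho / 2)%:A + rho^-1 *: sq_im w) =
    (2^-1 * (- b + rho))%:A - rho^-1 *: sq_im c.
  by apply: splitqP => /=; rewrite w1 w2 w3; ring.
split=> [[s /(sqsqrt_nonrealP _ _ _ wNreal) [rho [rho0]]]|[rho [rho0 Delta0 root ->]]].
  rewrite w0 KwE => /quadratic_rootP [Delta0 root] -> <-.
  by exists rho; rewrite xE.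
rewrite -xE; exists ((rho / 2)%:A + rho^-1 *: sq_im w) => //.
apply/sqsqrt_nonrealP => //; exists rho; split=> //.
by rewrite w0 KwE; apply/quadratic_rootP.
Qed.

(** The square of an imaginary [v] depends on [v] only through [K v], which is
    why the second disjunct is a whole quadric rather than finitely many
    points. *)
Lemma quad_sols_realP (R : realType) (b r : R) (x : splitq R) :
  quad_sols b r%:A x <->
  (exists2 y, y ^+ 2 = (b ^+ 2 - 4 * r) / 4 & x = (- b / 2 + y)%:A) \/
  (exists x1 x2 x3 : R,
     - x1 ^+ 2 + x2 ^+ 2 + x3 ^+ 2 = (b ^+ 2 - 4 * r) / 4 /\
     x = (- b / 2)%:A + x1 *: sqi + x2 *: sqj + x3 *: sqk).
Proof.
rewrite quad_sols_shift.
have -> : 4^-1 *: ((b ^+ 2)%:A - 4 *: r%:A) =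
    ((b ^+ 2 - 4 * r) / 4)%:A :> splitq R.
  by apply: splitqP => /=; field.
split=> [[s /sqsqrt_realP [[y yE ->]|[s0 Ks]] <-]|].
- by left; exists y => //; rewrite scalerDl.
- right; exists (sq1 s), (sq2 s), (sq3 s); split=> //.
  by apply: splitqP => /=; rewrite ?s0; ring.
case=> [[y yE ->]|[x1 [x2 [x3 [Kx ->]]]]].
  exists y%:A; last by rewrite scalerDl.
  by apply/sqsqrt_realP; left; exists y.
exists (SplitQ 0 x1 x2 x3); last by apply: splitqP => /=; ring.
by apply/sqsqrt_realP; right.
Qed.

Theorem theorem2p1 (R : realType) (b : R) (c : splitq R) :
  let w : splitq R := 4^-1 *: ((b ^+ 2)%:A - 4 *: c) in
  let D : R := b ^+ 2 - 4 * sq0 c in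
  let Delta : R := D ^+ 2 - 16 * sqK c in
  let vc : splitq R := sq1 c *: sqi + sq2 c *: sqj + sq3 c *: sqk in
  let t1 : R := (D + Num.sqrt Delta) / 2 in
  let t2 : R := (D - Num.sqrt Delta) / 2 in
  let xp (rho : R) : splitq R := (2^-1 * (- b + rho))%:A - rho^-1 *: vc in
  let xm (rho : R) : splitq R := (2^-1 * (- b - rho))%:A + rho^-1 *: vc in
  (* solvability and the general form of the solutions *)
  (quad_sols b c !=set0 <-> sqsqrt w !=set0) /\
  (quad_sols b c !=set0 ->
     quad_sols b c = [set (- b / 2)%:A + s | s in sqsqrt w]) /\
  (* (1) *)
  (forall r : R, c = r%:A -> b ^+ 2 < 4 * r ->
     quad_sols b c =
       [set x | exists x1 x2 x3 : R,
          - x1 ^+ 2 + x2 ^+ 2 + x3 ^+ 2 = (b ^+ 2 - 4 * r) / 4 /\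
          x = (- b / 2)%:A + x1 *: sqi + x2 *: sqj + x3 *: sqk]) /\
  (* (2) *)
  (forall r : R, c = r%:A -> 4 * r <= b ^+ 2 ->
     quad_sols b c =
       [set ((- b + Num.sqrt (b ^+ 2 - 4 * r)) / 2)%:A;
            ((- b - Num.sqrt (b ^+ 2 - 4 * r)) / 2)%:A] `|`
       [set x | exists x1 x2 x3 : R,
          - x1 ^+ 2 + x2 ^+ 2 + x3 ^+ 2 = (b ^+ 2 - 4 * r) / 4 /\
          x = (- b / 2)%:A + x1 *: sqi + x2 *: sqj + x3 *: sqk]) /\
  (* (3) *)
  (~ sq_real c -> 0 <= Delta -> 0 < t1 ->
     (0 < t2 ->
        quad_sols b c = [set xp (Num.sqrt t1); xm (Num.sqrt t1);
                             xp (Num.sqrt t2); xm (Num.sqrt t2)]) /\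
     (0 < t1 /\ t2 <= 0 ->
        quad_sols b c = [set xp (Num.sqrt t1); xm (Num.sqrt t1)])) /\
  (* (1)-(3) cover every solvable equation *)
  (quad_sols b c !=set0 -> ~ sq_real c -> 0 <= Delta /\ 0 < t1).
Proof.
move=> w D Delta vc t1 t2 xp xm.
have xmE rho : xm rho = xp (- rho).
  by rewrite /xm /xp invrN scaleNr opprK.
(* Both parts of (3), and the covering clause, are read off this description. *)
have solsP x : ~ sq_real c -> quad_sols b c x <-> 0 <= Delta /\
    (0 < t1 /\ (x = xp (Num.sqrt t1) \/ x = xm (Num.sqrt t1)) \/
     0 < t2 /\ (x = xp (Num.sqrt t2) \/ x = xm (Num.sqrt t2))).
  move=> cNreal; apply: (iff_trans (quad_sols_nonrealP b c x cNreal)).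
  have pm t : (exists rho, [/\ rho != 0, rho ^+ 2 = t & x = xp rho]) <->
      0 < t /\ (x = xp (Num.sqrt t) \/ x = xm (Num.sqrt t)).
    rewrite xmE; split=> [[rho [rho0 rhoE ->]]|[t0 xE]].
      have [t0 [->|->]] := (sqr_eq_sqrtP t rho).1 (conj rho0 rhoE).
        by split=> //; left.
      by split=> //; right.
    case: xE => xE.
      have [] := (sqr_eq_sqrtP t (Num.sqrt t)).2 (conj t0 (or_introl erefl)).
      by exists (Num.sqrt t).
    have [] := (sqr_eq_sqrtP t (- Num.sqrt t)).2 (conj t0 (or_intror erefl)).
    by exists (- Num.sqrt t).
  rewrite -!pm; split=> [[rho [rho0 Delta0 [rhoE|rhoE] xE]]|].
  - by split=> //; left; exists rho.
  - by split=> //; right; exists rho.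
  - case=> Delta0 [] [rho [rho0 rhoE xE]]; exists rho; split=> //; first by left.
    by right.
split; [|split; [|split; [|split; [|split]]]].
- rewrite quad_sols_shift; split=> [[_ [s sw _]]|[s sw]]; first by exists s.
  by exists ((- b / 2)%:A + s); exists s.
- by rewrite -quad_sols_shift.
- move=> r -> r_gt; apply/seteqP; split=> x.
    case/quad_sols_realP => // -[y yE _].
    by have := sqr_ge0 y; rewrite yE; lra.
  by move=> xE; apply/quad_sols_realP; right.
- move=> r -> r_le; set d := b ^+ 2 - 4 * r.
  have d0 : 0 <= d by rewrite subr_ge0.
  have sqrtE : (Num.sqrt d / 2) ^+ 2 = d / 4.
    by rewrite -[in RHS](sqr_sqrtr d0); field.
  apply/seteqP; split=> x.
    case/quad_sols_realP => [[y yE ->]|]; last by right.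
    left; rewrite -/d -sqrtE in yE.
    move/eqP: yE; rewrite eqf_sqr => /orP[] /eqP ->; [left|right];
      by congr (_%:A); field.
  case=> [[|] ->|xE]; apply/quad_sols_realP; last by right.
    by left; exists (Num.sqrt d / 2) => //; congr (_%:A); field.
  by left; exists (- (Num.sqrt d / 2)); rewrite ?sqrrN //; congr (_%:A); field.
- move=> cNreal Delta0 t1_gt0; split=> [t2_gt0|[_ t2_le0]].
    apply/seteqP; split=> x.
      case/(solsP _ cNreal) => _ [] [_] [] ->; rewrite /=; tauto.
    by move=> xE; apply/(solsP _ cNreal); move: xE; rewrite /=; tauto.
  apply/seteqP; split=> x.
    case/(solsP _ cNreal) => _ [] [t_gt0] xE; first exact: xE.
    by move: t_gt0; rewrite ltNge t2_le0.
  by move=> xE; apply/(solsP _ cNreal); split=> //; left.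
- move=> [x xE] cNreal; have [Delta0 t_gt0] := (solsP x cNreal).1 xE.
  split=> //; case: t_gt0 => -[t_gt0 _] //.
  (* A positive smaller root forces the larger one to be positive. *)
  by have := sqrtr_ge0 Delta; rewrite /t1; move: t_gt0; rewrite /t2; lra.
Qed.
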